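(* For every integer $n > 1$, stit logic does not have the Strong Restricted $n$-Craig Interpolation Property $(SRCIP)_n$; that is, there exist a set of propositional variables $V$ and formulas $A, B \in \mathcal{L}^{\{1,\ldots,n\}}_V$ with $\vdash A \to B$ and $Ag(A)\cap Ag(B) = \emptyset$ such that there is no $C \in \mathcal{L}^{\emptyset}_{|A|\cap|B|}$ (i.e. no formula over the shared variables containing no action modalities $[j]$) with both $\vdash A \to C$ and $\vdash C \to B$.
   Context: For a finite set $Ag$ of agent indices (possibly empty) and a set $V$ of propositional variables, $\mathcal{L}^{Ag}_V$ is the set of stit formulas given by $A ::= p \mid A \to A \mid \bot \mid \Box A \mid [j]A$ with $p \in V$, $j \in Ag$ (other Boolean connectives defined as usual; $\Diamond A := \neg\Box\neg A$); $\mathcal{L}^{\emptyset}_V$ contains no action modalities. $\vdash A$ means derivability in the axiom system $\mathbb{S}$ with axioms: all classical propositional tautologies; S5 axioms for $\Box$ and for each $[j]$; $\Box A \to [j]A$; and $(\Diamond[j_1]A_1 \wedge\dots\wedge \Diamond[j_k]A_k) \to \Diamond([j_1]A_1\wedge\dots\wedge[j_k]A_k)$ for pairwise distinct $j_1,\dots,j_k$; rules: modus ponens and necessitation for $\Box$. (This system is sound and strongly complete for the standard branching-time stit semantics.) For a formula $A$, $|A|$ is the set of propositional variables occurring in $A$ and $Ag(A)$ the set of agent indices occurring in $A$. *)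

(* Defs.v *)
From mathcomp Require Import all_boot.
From mathcomp Require Import classical_sets.

Set Implicit Arguments.
Unset Strict Implicit.
Unset Printing Implicit Defensive.

Local Open Scope classical_set_scope.

(* [form Ag V] is the language L^Ag_V. *)
Inductive form (Ag V : Type) : Type :=
| Var of V
| Imp of form Ag V & form Ag V
| Bot
| Box of form Ag V
| Stit of Ag & form Ag V.

Arguments Bot {Ag V}.
Arguments Var {Ag V} _.

Section Formulas.
Variables Ag V : Type.
Implicit Types A B : form Ag V.

Definition Neg A := Imp A Bot.
Definition And A B := Neg (Imp A (Neg B)).
Definition Dia A := Neg (Box (Neg A)).

(* Conjunction of the nonempty list A :: s, without a trailing Top. *)
Fixpoint conj A (s : seq (form Ag V)) : form Ag V :=
  if s is B :: s' then And A (conj B s') else A.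

(* The set |A|. *)
Fixpoint vars A : set V :=
  match A with
  | Var p => [set p]
  | Imp B C => vars B `|` vars C
  | Bot => set0
  | Box B => vars B
  | Stit _ B => vars B
  end.

(* The set Ag(A). *)
Fixpoint agents A : set Ag :=
  match A with
  | Var _ => set0
  | Imp B C => agents B `|` agents C
  | Bot => set0
  | Box B => agents B
  | Stit j B => j |` agents B
  end.

(* For G and W subsets of Ag and V, L^G_W as a sublanguage of L^Ag_V. *)
Definition sublang (G : set Ag) (W : set V) : set (form Ag V) :=
  [set A | agents A `<=` G /\ vars A `<=` W].

(* Variables and modal formulas alike are atoms for the Boolean valuation v. *)
Fixpoint truth (v : form Ag V -> bool) A : bool :=
  match A with
  | Imp B C => truth v B ==> truth v C
  | Bot => false
  | _ => v A
  end.

Definition tautology A : Prop := forall v, truth v A.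

Inductive S5_axiom (M : form Ag V -> form Ag V) : form Ag V -> Prop :=
| S5_K A B : S5_axiom M (Imp (M (Imp A B)) (Imp (M A) (M B)))
| S5_T A : S5_axiom M (Imp (M A) A)
| S5_4 A : S5_axiom M (Imp (M A) (M (M A)))
| S5_5 A : S5_axiom M (Imp (Neg (M A)) (M (Neg (M A)))).

End Formulas.

Section Derivability.
Variables (Ag : finType) (V : Type).

Inductive derivable : form Ag V -> Prop :=
| D_taut A : tautology A -> derivable A
| D_box A : S5_axiom (@Box Ag V) A -> derivable A
| D_stit j A : S5_axiom (Stit j) A -> derivable A
| D_incl j A : derivable (Imp (Box A) (Stit j A))
| D_indep j A (s : seq (Ag * form Ag V)) :
    uniq (j :: [seq x.1 | x <- s]) ->
    derivable
      (Imp (conj (Dia (Stit j A)) [seq Dia (Stit x.1 x.2) | x <- s])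
           (Dia (conj (Stit j A) [seq Stit x.1 x.2 | x <- s])))
| D_mp A B : derivable (Imp A B) -> derivable A -> derivable B
| D_nec A : derivable A -> derivable (Box A).

End Derivability.

(* Main.v *)
Require Import Defs.
From mathcomp Require Import all_boot.
From mathcomp Require Import classical_sets.

Local Open Scope classical_set_scope.

(** Take A := <>[0]p and B := ~<>[1]~p.  By independence of agents, <>[0]p and
    <>[1]~p would yield <>([0]p /\ [1]~p), which is absurd; hence |- A -> B.
    Now consider one moment with two histories, p true on exactly one of them,
    where a single distinguished agent sees the actual history and the choices
    of all others are vacuous.  With agent 0 distinguished A holds; with agent 1
    distinguished B fails.  A formula without action modalities cannot tell the
    two models apart, so it cannot interpolate. *)

(* Two-history moment: the worlds are the booleans, every variable holds exactly
   at [true], and [a] is the distinguished agent. *)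
Fixpoint eval {Ag : eqType} {V : Type} (a : Ag) (A : form Ag V) (w : bool) :
    bool :=
  match A with
  | Var _ => w
  | Imp B C => eval a B w ==> eval a C w
  | Bot => false
  | Box B => eval a B true && eval a B false
  | Stit j B => if j == a then eval a B w else eval a B true && eval a B false
  end.

Lemma truth_eval {Ag : eqType} {V : Type} (a : Ag) (w : bool) (A : form Ag V) :
  truth (fun B => eval a B w) A = eval a A w.
Proof. by elim: A => //= B -> C ->. Qed.

Lemma eval_Imp {Ag : eqType} {V : Type} (a : Ag) (A B : form Ag V) (w : bool) :
  eval a (Imp A B) w = (eval a A w ==> eval a B w).
Proof. by []. Qed.

Lemma eval_Dia {Ag : eqType} {V : Type} (a : Ag) (A : form Ag V) (w : bool) :
  eval a (Dia A) w = eval a A true || eval a A false.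
Proof. by rewrite /= !implybF negb_and !negbK. Qed.

Lemma eval_conj {Ag : eqType} {V : Type} (a : Ag) (w : bool) (A : form Ag V)
    (s : seq (form Ag V)) :
  eval a (conj A s) w = all (fun B => eval a B w) (A :: s).
Proof.
elim: s A => [|B s IH] A /=; first by rewrite andbT.
by rewrite !implybF IH negb_imply negbK.
Qed.

Lemma eval_Stit_neq {Ag : eqType} {V : Type} (a j : Ag) (A : form Ag V)
    (w u : bool) :
  j != a -> eval a (Stit j A) w -> eval a (Stit j A) u.
Proof. by move=> /= /negbTE ->. Qed.

(** Formulas [Stit j B] with [j != a] are constant across the two worlds, so only [a] restricts the
    choice of [u], and uniqueness lets [a] occur at most once. *)
Lemma eval_independence {Ag : eqType} {V : Type} (a : Ag) (w : bool)
    (s : seq (Ag * form Ag V)) :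
  uniq [seq x.1 | x <- s] ->
  all (fun x => eval a (Dia (Stit x.1 x.2)) w) s ->
  exists u, all (fun x => eval a (Stit x.1 x.2) u) s.
Proof.
elim: s => [|[j A] s IH]; first by exists w.
rewrite map_cons cons_uniq => /andP[js us] /andP[jA /(IH us)[u su]].
have [v jv] : exists v, eval a (Stit j A) v.
  move: (jA : eval a (Dia (Stit j A)) w); rewrite eval_Dia.
  by case/orP; [exists true | exists false].
have [ja|ja] := eqVneq j a; last first.
  exists u; apply/andP; split=> //.
  exact: (eval_Stit_neq _ _ _ v).
(* Here [a] dictates the world [v]; every agent in [s] differs from [a], so its formula carries over
   from [u] to [v]. *)
exists v; apply/andP; split=> [|{us jA jv IH}]; first exact: jv.
rewrite ja in js.
elim: s js su => // -[k B] s IH; rewrite map_cons inE negb_or eq_sym.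
move=> /andP[ka js] /andP[kB su]; apply/andP; split; last by apply: IH.
exact: (eval_Stit_neq _ _ _ u).
Qed.

(** Each modality is read as truth at both worlds or, for [Stit a], as the identity; both readings
    satisfy S5. *)
Lemma eval_sound {Ag : finType} {V : Type} (a : Ag) (A : form Ag V) (w : bool) :
  derivable A -> eval a A w.
Proof.
move=> dA; elim: dA w => {A}.
- by move=> A tA w; rewrite -truth_eval.
- move=> _ [A B|A|A|A] [] /=;
    by do ![case: (eval a _ true)]; do ![case: (eval a _ false)].
- move=> j _ [A B|A|A|A] [] /=; case: (j == a);
    by do ?[case: (eval a _ true)]; do ?[case: (eval a _ false)].
- by move=> j A [] /=; case: (j == a);
    case: (eval a A true); case: (eval a A false).
- move=> j A s us w.
  rewrite eval_Imp; apply/implyP; rewrite eval_conj eval_Dia !eval_conj.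
  (* The head [(j, A)] is folded back into the list to treat all agents uniformly. *)
  rewrite -!(map_cons (fun x => _) (j, A)) !all_map => all_dia.
  by have [[] ->] := eval_independence a w ((j, A) :: s) us all_dia;
    rewrite ?orbT.
- by move=> A B _ IHAB _ IHA w; have /implyP := IHAB w; apply.
- by move=> A _ IH w /=; rewrite !IH.
Qed.

Lemma eval_agentless {Ag : eqType} {V : Type} (a b : Ag) (A : form Ag V)
    (w : bool) :
  agents A `<=` set0 -> eval a A w = eval b A w.
Proof.
elim: A w => //= [B IHB C IHC|B IHB|j B _] w.
- by rewrite subUset => -[/IHB -> /IHC ->].
- by move=> /[dup] /IHB -> /IHB ->.
- by move=> /(_ j (or_introl erefl)).
Qed.

Lemma derivable_opposite_choices {Ag : finType} {V : Type} (i j : Ag)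
    (A : form Ag V) :
  i != j -> derivable (Imp (Dia (Stit i A)) (Neg (Dia (Stit j (Neg A))))).
Proof.
move=> ij; set X := Stit i A; set Y := Stit j (Neg A).
have indep : derivable (Imp (And (Dia X) (Dia Y)) (Dia (And X Y))).
  by apply: (@D_indep _ _ i A [:: (j, Neg A)]); rewrite /= inE ij.
have dXY : derivable (Neg (And X Y)).
  have dX : derivable (Imp X A) by apply: (@D_stit _ _ i); apply: S5_T.
  have dY : derivable (Imp Y (Neg A)) by apply: (@D_stit _ _ j); apply: S5_T.
  apply: D_mp dY; apply: D_mp dX; apply: D_taut => v /=.
  by case: (v X); case: (v Y); case: (truth v A).
(* Necessitation of [dXY] refutes [Dia (And X Y)]; the rest is propositional, with boxed formulas as
   atoms. *)
apply: D_mp (D_nec dXY); apply: D_mp indep; apply: D_taut => v /=.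
by case: (v (Box (Neg X))); case: (v (Box (Neg Y))); case: (v _).
Qed.

Theorem theorem4 (n : nat) (hn : 1 < n) :
  exists (V : Type) (A B : form 'I_n V),
    derivable (Imp A B) /\
    agents A `&` agents B = set0 /\
    ~ (exists C : form 'I_n V,
         sublang set0 (vars A `&` vars B) C /\
         derivable (Imp A C) /\ derivable (Imp C B)).
Proof.
pose i0 := Ordinal (ltnW hn); pose i1 := Ordinal hn.
pose p : form 'I_n unit := Var tt.
exists unit, (Dia (Stit i0 p)), (Neg (Dia (Stit i1 (Neg p)))); split.
  exact: derivable_opposite_choices.
split.
  by rewrite /= !setU0; apply/seteqP; split=> // j [/= -> /(congr1 val)].
(* The world [true] is arbitrary, but must be the same on both sides to compare the values of
   [C]. *)
case=> C [[C0 _] [/(eval_sound i0 _ true) AC /(eval_sound i1 _ true) CB]].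
by move: AC CB; rewrite /= (eval_agentless i0 i1) // => ->.
Qed.
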